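(* Let $\alpha\in(0,1)$ be irrational. There is a one-to-one correspondence between $\mathbb{Z}$ and the set of all finite right-admissible digit strings, given by the representation $T=\sum_{k=1}^n b_kq_{k-1}^*$. That is, for every integer $T$ there is exactly one finite right-admissible digit string $\langle b_k\rangle_{k=1}^n$ (with $n\ge0$, and $b_n\ge1$ if $n\ge1$) such that $T=\sum_{k=1}^n b_kq_{k-1}^*$. Moreover, its length $n$ is the index satisfying $T\in I_n^*\setminus I_{n-1}^*$.
   Context: For irrational $\alpha\in(0,1)$, set $\alpha_0=\alpha$ and, for $k\ge1$, $a_k=\lfloor 1/\alpha_{k-1}\rfloor$, $\alpha_k=1/\alpha_{k-1}-a_k$ (the continued fraction digits of $\alpha$). Let $q_{-1}=0,\ q_0=1,\ q_k=a_kq_{k-1}+q_{k-2}$ for $k\ge1$, and $q_k^*=(-1)^kq_k$. A finite right-admissible digit string is a sequence of integers $\langle b_k\rangle_{k=1}^n$, $n\ge0$ (the empty string if $n=0$), with $b_n\ge1$ if $n\ge1$, such that (i) $0\le b_k\le a_k$ for $1\le k\le n$; (ii) $b_k=a_k\implies b_{k+1}=0$ for $1\le k\le n-1$. Let $\rho_n\in\{0,1\}$ be the parity of $n$ ($0$ if $n$ is even, $1$ if $n$ is odd). Define $I_{-1}^*=\emptyset$ and $I_n^*=[\,1-q_{n-\rho_n},\ q_{n-\rho_{n-1}}\,]\cap\mathbb{Z}$ for $n\ge0$. Thus $I_n^*=[1-q_n,q_{n-1}]\cap\mathbb{Z}$ for $n$ even and $I_n^*=[1-q_{n-1},q_n]\cap\mathbb{Z}$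 for $n$ odd. *)

(* Defs.v *)
From mathcomp Require Import all_boot all_order all_algebra.
From mathcomp Require Import all_classical all_reals.

Set Implicit Arguments.
Unset Strict Implicit.
Unset Printing Implicit Defensive.

Import Order.TTheory GRing.Theory Num.Theory.
Local Open Scope classical_set_scope.
Local Open Scope ring_scope.

Fixpoint cf_rem (R : realType) (alpha : R) (k : nat) : R :=
  if k is k'.+1 then
    (cf_rem alpha k')^-1 - (Num.floor (cf_rem alpha k')^-1)%:~R
  else alpha.

(* Meaningful for 1 <= k only. *)
Definition cf_digit (R : realType) (alpha : R) (k : nat) : int :=
  Num.floor (cf_rem alpha k.-1)^-1.

(* The pair (q_{k-1}, q_k). *)
Fixpoint cf_den_pair (R : realType) (alpha : R) (k : nat) : int * int :=
  if k is k'.+1 then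
    let: (qp, qc) := cf_den_pair alpha k' in
    (qc, cf_digit alpha k * qc + qp)
  else (0, 1).

(* Extended by zero below q_{-1} = 0. *)
Definition cf_den (R : realType) (alpha : R) (k : int) : int :=
  if k is Posz k' then (cf_den_pair alpha k').2 else 0.

Definition cf_den_star (R : realType) (alpha : R) (k : nat) : int :=
  (-1) ^+ k * cf_den alpha k%:Z.

(* Strings are indexed from 1: the k-th digit of b is b_k for
   1 <= k <= size b. *)
Definition digit (b : seq int) (k : nat) : int := b`_(k.-1).

Definition right_admissible (R : realType) (alpha : R) (b : seq int) : Prop :=
  [/\ (1 <= size b)%N -> 1 <= digit b (size b),
      forall k : nat, (1 <= k <= size b)%N ->
        0 <= digit b k <= cf_digit alpha k
    & forall k : nat, (1 <= k < size b)%N ->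
        digit b k = cf_digit alpha k -> digit b k.+1 = 0].

Definition represented (R : realType) (alpha : R) (b : seq int) : int :=
  \sum_(1 <= k < (size b).+1) digit b k * cf_den_star alpha k.-1.

Definition parity (n : int) : int := (odd `|n|%N)%:Z.

(* Posz covers n >= 0; the only negative index of interest is n = -1. *)
Definition Istar (R : realType) (alpha : R) (n : int) : set int :=
  if n is Posz _ then
    [set T : int | 1 - cf_den alpha (n - parity n) <= T
                     <= cf_den alpha (n - parity (n - 1))]
  else set0.

(* Main.v *)
(* Peeling off the last digit is division with remainder.  Allow a zero last
   digit and fix the length n.  The strings of length n then take each value in
   I*_n exactly once, and those with b_n < a_n take each value of a subinterval
   J_n of q_n consecutive integers exactly once.  The translates
   J_n + d q*_n, 1 <= d <= a_{n+1}, tile I*_{n+1} \ I*_n, and rule (ii) says that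
   a nonzero digit b_{n+1} = d may only follow a string with value in J_n.  So
   the last digit is determined by the value, and it is nonzero exactly when the
   value lies outside the previous interval. *)
Require Import Defs.
From mathcomp Require Import all_boot all_order all_algebra.
From mathcomp Require Import all_classical all_reals.
From mathcomp Require Import zify.
Import Order.TTheory GRing.Theory Num.Theory.
Local Open Scope classical_set_scope.
Local Open Scope ring_scope.

(** * Positivity of the continued fraction digits *)

Lemma irrational_rem {R : realType} {x : R} (m : int) :
  irrational x -> irrational (x^-1 - m%:~R).
Proof.
move=> xirr [r _ rE]; apply: xirr; exists (r + m%:~R)^-1 => //.
by rewrite fmorphV rmorphD /= rE ratr_int subrK invrK.
Qed.

Lemma cf_rem_irrational {R : realType} {alpha : R} k :
  irrational alpha -> irrational (cf_rem alpha k).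
Proof. by move=> airr; elim: k => //= k; exact: irrational_rem. Qed.

Lemma cf_rem_itv {R : realType} {alpha : R} k :
  0 < alpha < 1 -> irrational alpha -> 0 < cf_rem alpha k < 1.
Proof.
move=> a01 airr; case: k => //= k.
set y := (cf_rem alpha k)^-1; have /andP[yge ylt] := floor_itv y.
rewrite subr_gt0 ltrBlDl -intrD1 ylt andbT lt_neqAle yge andbT.
(* A fractional part 0 would make the next remainder rational. *)
apply/eqP => yE; apply: (cf_rem_irrational k.+1 airr).
by exists 0 => //; rewrite rmorph0 /= -/y yE subrr.
Qed.

Lemma cf_digit_ge1 {R : realType} {alpha : R} k :
  0 < alpha < 1 -> irrational alpha -> 1 <= cf_digit alpha k.
Proof.
move=> a01 airr; have /andP[x0 x1] := cf_rem_itv k.-1 a01 airr.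
by rewrite /cf_digit floor_ge_int invf_ge1 // ltW.
Qed.

Set Implicit Arguments.
Unset Strict Implicit.

Section Expansion.
Context {R : realType} {alpha : R}
  (digit_ge1 : forall k, 1 <= cf_digit alpha k).

Local Notation a := (cf_digit alpha).
Local Notation q n := (cf_den_pair alpha n).2.
Local Notation qm n := (cf_den_pair alpha n).1.
Local Notation qstar := (cf_den_star alpha).
Local Notation value := (represented alpha).

(** * Growth of the denominators and nested intervals *)

Lemma qmS n : qm n.+1 = q n.
Proof. by rewrite /=; case: cf_den_pair. Qed.

Lemma qS n : q n.+1 = a n.+1 * q n + qm n.
Proof. by rewrite /=; case: cf_den_pair. Qed.

Lemma q_bounds n : 0 <= qm n <= q n /\ 0 < q n.
Proof.
elim: n => [//|n [IH q0]]; rewrite qmS qS.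
have := ler_peMl (ltW q0) (digit_ge1 n.+1); lia.
Qed.

Lemma q_geS n : q n + qm n <= q n.+1.
Proof. by rewrite qS lerD2r ler_peMl // ltW; case: (q_bounds n). Qed.

(** Makes the intervals exhaust the integers. The strict bound carries the induction through
    [q_geS]. *)
Lemma q_ge_index n : n%:Z <= q n /\ n%:Z < q n + qm n.
Proof.
elim: n => [//|n]; have := q_geS n; have := q_bounds n.
rewrite qmS; lia.
Qed.

(* The reflection T |-> 1 - T for odd n turns I*_n into [1 - q_n, q_{n-1}],
   so that both parities of n are treated at once. *)
Definition flip (n : nat) (T : int) : int := if odd n then 1 - T else T.

Definition inI n T := 1 - q n <= flip n T <= qm n.
(** J_n: in the coordinate [flip n], the top [q n] integers of I*_n. *)
Definition inJ n T := 1 - q n + qm n <= flip n T <= qm n.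

Lemma flipS n T : flip n.+1 T = 1 - flip n T.
Proof. by rewrite /flip /=; case: odd => /=; lia. Qed.

Lemma flipD n T d : flip n (T + d * qstar n) = flip n T + d * q n.
Proof.
by rewrite /flip /cf_den_star -signr_odd; case: odd => /=; lia.
Qed.

(** Level n+1 is read in the coordinate [flip n], where adding [d * qstar n] is a shift by
    [d * q n]. *)
Lemma inIS n T : inI n.+1 T = (1 - q n <= flip n T <= q n.+1).
Proof. by rewrite /inI flipS qmS; lia. Qed.

Lemma inJS n T : inJ n.+1 T = (1 - q n <= flip n T <= q n.+1 - q n).
Proof. by rewrite /inJ flipS qmS; lia. Qed.

Lemma sub_inI n T : inI n T -> inI n.+1 T.
Proof. by rewrite inIS /inI; have := q_geS n; have := q_bounds n; lia. Qed.

Lemma le_inI {m n} T : (m <= n)%N -> inI m T -> inI n T.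
Proof.
by move=> /subnK <-; elim: (n - m)%N => // k IH /IH; exact: sub_inI.
Qed.

Lemma IstarE (n : nat) (T : int) : Istar alpha n T <-> inI n T.
Proof.
(* For n = 0 the right endpoint is [cf_den] at -1, whose value 0 agrees with [qm 0]. *)
case: n => [|n]; first by rewrite /Istar /inI /flip /=; lia.
rewrite inIS /Istar /flip /parity; have nE : n.+1%:Z - 1 = n by lia.
rewrite nE /absz oddS; case: (odd n); rewrite /= ?addn0 ?subn1 /=;
  case: cf_den_pair => u v /=; lia.
Qed.

(** * The last digit as a quotient *)

Lemma last_digit_inI n x d :
  inI n x -> (d != 0 -> inJ n x) -> 0 <= d <= a n.+1 ->
  inI n.+1 (x + d * qstar n).
Proof.
rewrite inIS flipD /inI /inJ qS => xI xJ /andP[d0 da].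
have [q0m q0] := q_bounds n; have := ler_wpM2r (ltW q0) da.
have [->|dN0] := eqVneq d 0; first by have := digit_ge1 n.+1; lia.
by have := xJ dN0; have : 1 * q n <= d * q n; [rewrite ler_pM2r // | ]; lia.
Qed.

(** In the coordinate [flip n], J_{n+1} is I*_{n+1} without its top [q n] integers, and these form
    the translate of J_n by the full digit [a n.+1]. *)
Lemma last_digit_inJ n x d :
  inI n x -> (d != 0 -> inJ n x) -> 0 <= d <= a n.+1 ->
  inJ n.+1 (x + d * qstar n) = (d < a n.+1).
Proof.
rewrite inJS flipD /inI /inJ qS => xI xJ /andP[d0 da].
have [q0m q0] := q_bounds n; apply/idP/idP.
  have [->|dN0] := eqVneq d 0; first by have := digit_ge1 n.+1; lia.
  have := xJ dN0; rewrite lt_neqAle da andbT => xJ'.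
  by apply: contraTneq => ->; lia.
move=> da'; have : (d + 1) * q n <= a n.+1 * q n by rewrite ler_pM2r //; lia.
have [->|dN0] := eqVneq d 0; first by lia.
by have := xJ dN0; have : 1 * q n <= d * q n; [rewrite ler_pM2r // | ]; lia.
Qed.

(** A shift by at least [q n] moves the bottom of J_n past [qm n], the top of I*_n. *)
Lemma last_digit_notin n x d :
  inJ n x -> 0 < d -> ~~ inI n (x + d * qstar n).
Proof.
rewrite /inI /inJ flipD => xJ d0; have [_ q0] := q_bounds n.
by have : 1 * q n <= d * q n; [rewrite ler_pM2r // | ]; lia.
Qed.

Lemma last_digit_inj n x x' d d' :
  0 <= d -> 0 <= d' -> inI n x -> (d != 0 -> inJ n x) ->
  inI n x' -> (d' != 0 -> inJ n x') ->
  x + d * qstar n = x' + d' * qstar n -> d = d'.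
Proof.
move=> d0 d'0 xI xJ x'I x'J E.
have [d_0|dN0] := eqVneq d 0; have [d'_0|d'N0] := eqVneq d' 0.
- by rewrite d_0 d'_0.
- have := @last_digit_notin n x' d' (x'J d'N0).
  by rewrite -E d_0 mul0r addr0 xI; lia.
- have := @last_digit_notin n x d (xJ dN0).
  by rewrite E d'_0 mul0r addr0 x'I; lia.
(* Both digits are nonzero, so x and x' lie in J_n and differ by less than [q n]. *)
have := congr1 (flip n) E; rewrite !flipD.
have := xJ dN0; have := x'J d'N0; rewrite /inJ; have [_ q0] := q_bounds n.
by nia.
Qed.

Lemma last_digit_exists n T :
  inI n.+1 T ->
  exists x d, [/\ T = x + d * qstar n, 0 <= d <= a n.+1, inI n x
                & d != 0 -> inJ n x].
Proof.
have [/andP[qm0 _] q0] := q_bounds n => TI.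
have [TIn|TnI] := boolP (inI n T).
  exists T, 0; split=> //; first by rewrite mul0r addr0.
  by have := digit_ge1 n.+1; lia.
move: TI TnI; rewrite inIS qS /inI => TI TnI.
(* d is (y - q_{n-1}) / q_n rounded up. *)
set y := flip n T in TI TnI; pose u := y - qm n + q n - 1.
pose d := (u %/ q n)%Z; exists (T - d * qstar n), d.
have uE := divz_eq u (q n); have r0 := @modz_ge0 u (q n) ltac:(lia).
have r1 := @ltz_pmod u (q n) q0.
have flipE : flip n (T - d * qstar n) = y - d * q n.
  by rewrite -mulNr flipD mulNr.
rewrite /inI /inJ flipE; move: uE r0 r1; rewrite -/d /u.
move: (_ %% _)%Z (d) => r e uE r0 r1.
(* Since y lies above I*_n, [qm n < y <= q n.+1], which confines the quotient. The remainder r then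
   places [y - e * q n] in J_n, r steps above its bottom. *)
have ? : 0 <= e <= a n.+1 by apply/andP; split; nia.
by split; rewrite ?subrK //; nia.
Qed.

(** * Strings of fixed length, trailing zeros allowed *)

Definition padded (b : seq int) : Prop :=
  (forall k : nat, (1 <= k <= size b)%N -> 0 <= digit b k <= a k) /\
  (forall k : nat, (1 <= k < size b)%N ->
     digit b k = a k -> digit b k.+1 = 0).

(** Whether rule (ii) lets a nonzero digit follow b; always so for the empty string. *)
Definition extensible (b : seq int) : bool :=
  (0 < size b)%N ==> (digit b (size b) < a (size b)).

Lemma digit_rcons b d k :
  (1 <= k <= size b)%N -> digit (rcons b d) k = digit b k.
Proof. by case: k => // k /andP[_ kb]; rewrite /digit nth_rcons kb. Qed.

Lemma digit_rcons_last b d : digit (rcons b d) (size b).+1 = d.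
Proof. by rewrite /digit nth_rcons ltnn eqxx. Qed.

Lemma padded_rcons b d :
  padded (rcons b d) <->
  [/\ padded b, 0 <= d <= a (size b).+1 & d != 0 -> extensible b].
Proof.
split=> [[dig nxt]|[[dig nxt] dI dext]].
  rewrite size_rcons in dig nxt; split.
  - split=> k kb; first by rewrite -(@digit_rcons b d) //; apply: dig; lia.
    by rewrite -!(@digit_rcons b d); [apply: nxt; lia|lia|lia].
  - by have := dig (size b).+1; rewrite digit_rcons_last; apply; lia.
  - move=> d0; apply/implyP => b0; have bI : (1 <= size b <= size b)%N by lia.
    have := dig (size b); rewrite digit_rcons // lt_neqAle.
    move=> /(_ ltac:(lia))/andP[_ ->]; rewrite andbT.
    apply: contra d0 => /eqP bE; rewrite -(digit_rcons_last b d).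
    by rewrite nxt ?digit_rcons //; lia.
split=> k; rewrite size_rcons => kb.
  have [->|kn] := eqVneq k (size b).+1; first by rewrite digit_rcons_last.
  by rewrite digit_rcons ?dig //; lia.
rewrite digit_rcons; last by lia.
have [kE|kn] := eqVneq k (size b).
  rewrite kE digit_rcons_last => bE; apply/eqP; apply: contraTT isT => /dext.
  by rewrite /extensible bE ltxx implybF -ltnNge; lia.
by rewrite digit_rcons; [apply: nxt; lia|lia].
Qed.

Lemma represented_rcons b d :
  value (rcons b d) = value b + d * qstar (size b).
Proof.
rewrite /represented size_rcons big_nat_recr //= digit_rcons_last.
congr (_ + _); apply: eq_big_nat => k kb; rewrite digit_rcons //; lia.
Qed.

Lemma represented_nil : value [::] = 0.
Proof. by rewrite /represented big_geq. Qed.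

(** Both claims go through one induction: the equality turns rule (ii) into the membership in J_n
    that the last-digit lemmas require. *)
Lemma padded_bounds b :
  padded b -> inI (size b) (value b) /\ inJ (size b) (value b) = extensible b.
Proof.
elim/last_ind: b => [_|b d IH /padded_rcons[bP dI dext]].
  by rewrite represented_nil.
have [bI bJ] := IH bP; rewrite represented_rcons size_rcons.
rewrite -bJ in dext; rewrite last_digit_inI // last_digit_inJ //.
by rewrite /extensible size_rcons digit_rcons_last.
Qed.

Lemma padded_inj b b' :
  size b = size b' -> padded b -> padded b' -> value b = value b' -> b = b'.
Proof.
elim/last_ind: b b' => [|b d IH] b'; first by case: b'.
elim/last_ind: b' => [|b' d' _]; first by rewrite size_rcons.
rewrite !size_rcons => -[bE] /padded_rcons[bP dI dext].
move=> /padded_rcons[b'P d'I d'ext]; rewrite !represented_rcons -bE => E.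
have [bI bJ] := padded_bounds bP; have [b'I b'J] := padded_bounds b'P.
rewrite -bJ in dext; rewrite -b'J -bE in d'ext; rewrite -bE in b'I.
have dE : d = d'.
  by have [d0 _] := andP dI; have [d'0 _] := andP d'I; exact: last_digit_inj E.
by rewrite dE in E *; rewrite (IH b') //; exact: addIr E.
Qed.

Lemma padded_exists n T :
  inI n T -> exists b, [/\ size b = n, padded b & value b = T].
Proof.
elim: n T => [|n IH] T.
  move=> TI; exists [::]; split=> //; rewrite ?represented_nil.
    by split=> k /=; lia.
  by move: TI; rewrite /inI /flip /=; lia.
move=> /last_digit_exists[x [d [-> dI xI xJ]]].
move: xI dI xJ => /IH[b [<- bP <-]] dI xJ.
exists (rcons b d); rewrite size_rcons represented_rcons; split=> //.
by apply/padded_rcons; split=> // /xJ; have [_ ->] := padded_bounds bP.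
Qed.

(** * Nonzero last digit, length and the correspondence *)

Lemma right_admissibleE b :
  right_admissible alpha b <->
  padded b /\ ((1 <= size b)%N -> 1 <= digit b (size b)).
Proof. by split=> [[]|[[]]]. Qed.

(** The nonzero last digit pushes the value out of the preceding interval, hence out of all earlier
    ones by nesting. *)
Lemma right_admissible_size b :
  right_admissible alpha b ->
  inI (size b) (value b) /\ forall n, (n < size b)%N -> ~~ inI n (value b).
Proof.
move=> /right_admissibleE[bP blast]; split; first by case: (padded_bounds bP).
move=> n nb; elim/last_ind: b => // b d _ in bP blast nb *.
move: blast nb; rewrite size_rcons digit_rcons_last => /(_ isT) d1 nb.
have /padded_rcons[b'P dI dext] := bP; have [_ bJ] := padded_bounds b'P.
rewrite represented_rcons; apply: contra (@le_inI _ (size b) _ nb) _.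
by apply: last_digit_notin; [rewrite bJ dext|]; lia.
Qed.

Lemma right_admissible_exists T :
  exists b, right_admissible alpha b /\ T = value b.
Proof.
have exI : exists n, inI n T.
  (* The index |T| + 2 suffices: T and 1 - T both lie between -|T| and |T| + 1. *)
  exists `|T|%N.+2; rewrite inIS; have := q_ge_index `|T|%N.+1.
  have := q_ge_index `|T|%N.+2; rewrite /flip; case: odd; lia.
case: (ex_minnP exI) => n /padded_exists[b [<- bP <-]] nmin.
exists b; split=> //; apply/right_admissibleE; split=> //.
elim/last_ind: b => // b d _ in bP nmin *; move=> _.
have /padded_rcons[b'P /andP[d0 _] _] := bP.
(* Dropping a zero last digit would keep the value and contradict the minimality of the length. *)
rewrite size_rcons digit_rcons_last; apply: contraT => dlt.
have d_0 : d = 0 by lia.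
have := nmin (size b); rewrite represented_rcons size_rcons d_0 mul0r addr0.
by have [-> _] := padded_bounds b'P; lia.
Qed.

(** The guard [0 < n] accounts for the empty set at index -1, where [n.-1] truncates to 0. *)
Lemma Istar_predE (n : nat) T :
  Istar alpha (n%:Z - 1) T <-> (0 < n)%N /\ inI n.-1 T.
Proof.
case: n => [|n]; first by split=> // -[].
rewrite (_ : n.+1%:Z - 1 = n); last by lia.
by split=> [/IstarE|[_ ?]]; [|apply/IstarE].
Qed.

Lemma Istar_sizeP b (n : nat) :
  right_admissible alpha b ->
  (Istar alpha n%:Z `\` Istar alpha (n%:Z - 1)) (value b) <-> n = size b.
Proof.
move=> /right_admissible_size[bI bnI].
split=> [[/IstarE nI npI]|->]; last first.
  split; first exact/IstarE.
  by move=> /Istar_predE[b0]; apply/negP/bnI; rewrite prednK.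
have [/bnI/negP//|bn|//] := ltngtP n (size b).
case: npI; apply/Istar_predE; split; first by lia.
by apply: le_inI bI; lia.
Qed.

End Expansion.

Theorem theorem2p2 (R : realType) (alpha : R)
    (halpha01 : 0 < alpha < 1) (halpha : irrational alpha) (T : int) :
  (exists! b : seq int,
     right_admissible alpha b /\ T = represented alpha b) /\
  (forall b : seq int,
     right_admissible alpha b -> T = represented alpha b ->
     forall n : nat,
       (Istar alpha n%:Z `\` Istar alpha (n%:Z - 1)) T <-> n = size b).
Proof.
have age1 k := @cf_digit_ge1 R alpha k halpha01 halpha.
have sizeP b : right_admissible alpha b -> T = represented alpha b ->
    forall n : nat,
      (Istar alpha n%:Z `\` Istar alpha (n%:Z - 1)) T <-> n = size b.
  by move=> ? -> n; exact: Istar_sizeP.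
split=> //; have [b [badm Tb]] := right_admissible_exists age1 T.
exists b; split=> // b' [b'adm Tb'].
have [bP _] := (right_admissibleE b).1 badm.
have [b'P _] := (right_admissibleE b').1 b'adm.
(* The lengths agree because each is the one index n with T in I*_n but not in I*_{n-1}. *)
apply: padded_inj bP b'P _ => //; last by rewrite -Tb.
by apply/(sizeP b' b'adm Tb'); apply/(sizeP b badm Tb).
Qed.
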